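(* Let $f,g:X\to Y$ be fibrewise pointed maps between fibrewise pointed spaces over a topological space $B$. Let $\widetilde\Pi_Y:\mathcal{P}_B(f,g)\to X$ be the pullback of $\Pi_Y:P_B(Y)\to Y\times_B Y$ along $(f,g):X\to Y\times_B Y$, regarded as a fibrewise pointed map, and let $\widetilde\Pi_Y^*:H_B^*(X)\to H_B^*(\mathcal{P}_B(f,g))$ be the induced homomorphism in fibrewise pointed cohomology. Then $$\mathrm{nil}(\ker(\widetilde\Pi_Y^* ))\le D_B^B(f,g).$$
   Context: Fix a topological space $B$ and let $I=[0,1]$. A fibrewise pointed space over $B$ is a space $X$ with continuous maps $p_X:X\to B$, $s_X:B\to X$ such that $p_X\circ s_X=id_B$. A fibrewise pointed map $f:X\to Y$ is a continuous map with $p_Y\circ f=p_X$ and $f\circ s_X=s_Y$. Subsets of $X$ containing $s_X(B)$ are fibrewise pointed spaces. Two fibrewise pointed maps $f,g:X\to Y$ are fibrewise pointed homotopic, $f\simeq^B_B g$, if there is a homotopy $H:X\times I\to Y$ from $f$ to $g$ with $p_Y(H(x,t))=p_X(x)$ and $H(s_X(b),t)=s_Y(b)$ for all $x,b,t$. Parametrized pointed homotopic distance: $D_B^B(f,g)$ is the smallest integer $n\ge0$ such that $X$ has an open cover $\{U_0,\dots,U_n\}$ with $s_X(B)\subset U_i$ and $f|_{U_i}\simeq^B_B g|_{U_i}$ for all $i$; $\infty$ if none exists. $Y\times_B Y=\{(y,y')\in Y\times Y:p_Y(y)=p_Y(y')\}$, with section $b\mapsto(s_Y(b),s_Y(b))$.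 $P_B(Y)=\{(b,\alpha)\in B\times Y^I: p_Y\circ\alpha \text{ is the constant path at } b\}$ (compact-open topology on $Y^I$), with section sending $b$ to $(b,\text{constant path at }s_Y(b))$, and $\Pi_Y(b,\alpha)=(\alpha(0),\alpha(1))$. The pullback is $\mathcal{P}_B(f,g)=\{(x,(b,\alpha))\in X\times P_B(Y):\alpha(0)=f(x),\alpha(1)=g(x)\}$, with $\widetilde\Pi_Y(x,(b,\alpha))=x$ and section induced from those of $X$ and $P_B(Y)$. Fibrewise pointed cohomology: $H_B^*(X):=H^*(X,s_X(B);R)$, singular cohomology with coefficients in a commutative ring $R$ with unity, with its cup product; a fibrewise pointed map induces a homomorphism via the map of pairs. For an ideal $J$, $\mathrm{nil}(J)$ is the smallest $n\ge0$ such that every cup product of $n+1$ elements of $J$ vanishes. *)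

(* Defs.v *)
From HB Require Import structures.
From mathcomp Require Import all_boot all_order all_algebra.
From mathcomp Require Import ring.
From mathcomp Require Import generic_quotient ring_quotient.
From mathcomp Require Import all_classical all_reals all_analysis.

Set Implicit Arguments.
Unset Strict Implicit.
Unset Printing Implicit Defensive.

Import Order.TTheory GRing.Theory Num.Theory.
Import numFieldNormedType.Exports.

Local Open Scope classical_set_scope.
Local Open Scope ring_scope.

(* the smallest element of [S], and [+oo] when [S] is empty *)
Definition least (S : set nat) : \bar int :=
  if pselect (exists n, n \in S) is left exS then ((ex_minn exS)%:Z)%:E
  else +oo%E.


Record fpSpace (B : topologicalType) := FpSpace {
  fp_space :> topologicalType;
  fp_proj : fp_space -> B;
  fp_sec : B -> fp_space;
  fp_proj_cts : continuous fp_proj;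
  fp_sec_cts : continuous fp_sec;
  fp_secK : cancel fp_sec fp_proj }.

Arguments fp_proj {B} _ _.
Arguments fp_sec {B} _ _.

Record fpMap (B : topologicalType) (X Y : fpSpace B) := FpMap {
  fp_fun :> X -> Y;
  fp_fun_cts : continuous fp_fun;
  fp_fun_proj : forall x, fp_proj Y (fp_fun x) = fp_proj X x;
  fp_fun_sec : forall b, fp_fun (fp_sec X b) = fp_sec Y b }.

Lemma set_val_cts (T : topologicalType) (A : set T) :
  continuous (set_val : A -> T).
Proof. exact: initial_continuous. Qed.

Lemma cts_to_subset (S T : topologicalType) (A : set T) (f : S -> A) :
  continuous (set_val \o f) -> continuous f.
Proof. exact: continuous_comp_initial. Qed.

Lemma fst_cts (S T : topologicalType) : continuous (@fst S T).
Proof. by move=> z; exact: cvg_fst. Qed.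

Lemma snd_cts (S T : topologicalType) : continuous (@snd S T).
Proof. by move=> z; exact: cvg_snd. Qed.

Lemma pair_cts (U S T : topologicalType) (f : U -> S) (g : U -> T) :
  continuous f -> continuous g -> continuous (fun x => (f x, g x)).
Proof. by move=> cf cg x; apply: cvg_pair; [exact: cf|exact: cg]. Qed.

Lemma comp_cts (U S T : topologicalType) (f : U -> S) (g : S -> T) :
  continuous f -> continuous g -> continuous (g \o f).
Proof. by move=> cf cg x; apply: continuous_comp; [exact: cf|exact: cg]. Qed.

Section FpOfSet.
Variables (B T : topologicalType) (A : set T) (p : T -> B) (s : B -> T).
Hypotheses (p_cts : continuous p) (s_cts : continuous s).
Hypotheses (sK : cancel s p) (sA : forall b, A (s b)).

Definition of_set_proj (x : A) : B := p (set_val x).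
Definition of_set_sec (b : B) : A := exist _ (s b) (mem_set (sA b)).

Lemma of_set_proj_cts : continuous of_set_proj.
Proof. exact: comp_cts (@set_val_cts T A) p_cts. Qed.

Lemma of_set_sec_cts : continuous of_set_sec.
Proof. exact: cts_to_subset. Qed.

Lemma of_set_secK : cancel of_set_sec of_set_proj.
Proof. by move=> b; exact: sK. Qed.

(* a subset [A] of a topological space, made fibrewise pointed by [p] and [s] *)
Definition fp_of_set : fpSpace B :=
  FpSpace of_set_proj_cts of_set_sec_cts of_set_secK.
End FpOfSet.

Section Sub.
Variables (B : topologicalType) (X Y : fpSpace B) (U : set X).
Hypothesis secU : forall b, U (fp_sec X b).

Definition fp_sub : fpSpace B :=
  fp_of_set (@fp_proj_cts _ X) (@fp_sec_cts _ X) (@fp_secK _ X) secU.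

Variable f : fpMap X Y.
Definition restrict_fun (x : fp_sub) : Y := f (set_val x).

Lemma restrict_fun_cts : continuous restrict_fun.
Proof. exact: comp_cts (@set_val_cts X U) (@fp_fun_cts _ _ _ f). Qed.

Lemma restrict_fun_proj x : fp_proj Y (restrict_fun x) = fp_proj fp_sub x.
Proof. exact: fp_fun_proj. Qed.

Lemma restrict_fun_sec b : restrict_fun (fp_sec fp_sub b) = fp_sec Y b.
Proof. exact: fp_fun_sec. Qed.

Definition fp_restrict : fpMap fp_sub Y :=
  FpMap restrict_fun_cts restrict_fun_proj restrict_fun_sec.
End Sub.


Section UnitInterval.
Variable RR : realType.

(* [RR] is an arbitrary model of the real numbers; [set_type] carries the
   subspace topology *)
Definition unit_interval : topologicalType := `[0 : RR, 1 : RR]%classic.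

Lemma unit_interval0_proof : `[0 : RR, 1 : RR]%classic 0.
Proof. by rewrite /= in_itv /= lexx ler01. Qed.

Lemma unit_interval1_proof : `[0 : RR, 1 : RR]%classic 1.
Proof. by rewrite /= in_itv /= lexx ler01. Qed.

Definition I0 : unit_interval := exist _ 0 (mem_set unit_interval0_proof).
Definition I1 : unit_interval := exist _ 1 (mem_set unit_interval1_proof).
End UnitInterval.
Arguments I0 {RR}.
Arguments I1 {RR}.

Section Homotopy.
Variables (RR : realType) (B : topologicalType) (X Y : fpSpace B).

Definition fp_homotopic (f g : fpMap X Y) : Prop :=
  exists H : X * unit_interval RR -> Y,
    [/\ continuous H,
        forall x, H (x, I0) = f x,
        forall x, H (x, I1) = g x,
        forall x t, fp_proj Y (H (x, t)) = fp_proj X x &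
        forall b t, H (fp_sec X b, t) = fp_sec Y b].

End Homotopy.

Section Distance.
Variables (RR : realType) (B : topologicalType) (X Y : fpSpace B).

Definition fp_distance (f g : fpMap X Y) : \bar int :=
  least [set n : nat |
    exists (U : 'I_n.+1 -> set X) (secU : forall i b, U i (fp_sec X b)),
      [/\ forall i, open (U i),
          \bigcup_i U i = [set: X] &
          forall i, fp_homotopic RR (fp_restrict (secU i) f)
                                    (fp_restrict (secU i) g)]].
End Distance.


Section FibreSquare.
Variables (B : topologicalType) (Y : fpSpace B).

Definition square_set : set (Y * Y) :=
  [set y | fp_proj Y y.1 = fp_proj Y y.2].

Definition fp_square : fpSpace B.
Proof.
refine (@fp_of_set B (Y * Y)%type square_set (fun y => fp_proj Y y.1)
  (fun b => (fp_sec Y b, fp_sec Y b)) _ _ _ _).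
- exact: comp_cts (@fst_cts Y Y) (@fp_proj_cts _ Y).
- exact: pair_cts (@fp_sec_cts _ Y) (@fp_sec_cts _ Y).
- by move=> b; exact: fp_secK.
- by [].
Defined.
End FibreSquare.

Section PathSpace.
Variables (RR : realType) (B : topologicalType) (Y : fpSpace B).

(* [Y^I]: the continuous maps only, with the compact-open topology *)
Definition paths : Type := continuousType (unit_interval RR) Y.
HB.instance Definition _ := Choice.on paths.
HB.instance Definition _ := Topological.copy paths
  (@initial_topology paths {compact-open, unit_interval RR -> Y}
    (fun a : continuousType (unit_interval RR) Y => (a : unit_interval RR -> Y))).

Definition path_fun (a : paths) : unit_interval RR -> Y :=
  (a : continuousType (unit_interval RR) Y).

Definition const_path (y : Y) : paths := (cst y : continuousType _ _).

Lemma path_eval_cts t : continuous (fun a : paths => path_fun a t).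
Proof.
apply/continuousP => O oO.
exists [set g : {compact-open, unit_interval RR -> Y} | g @` [set t] `<=` O].
  by apply: compact_open_open => //; exact: compact_set1.
apply/seteqP; split => a /=; first by apply; exists t.
by move=> Oat _ [x xt <-]; rewrite xt.
Qed.

Lemma const_path_cts : continuous const_path.
Proof.
apply: continuous_comp_initial.
suff h : continuous (cst : Y -> {compact-open, unit_interval RR -> Y}) by exact: h.
move=> y; apply/compact_open_cvgP => K O cK oO KO.
have [[t Kt]|K0] := pselect (exists t, K t); last first.
  by apply: filterE => z w [s Ks _]; exfalso; apply: K0; exists s.
have Oy : O y by apply: KO; exists t.
apply: filterS (open_nbhs_nbhs (conj oO Oy)).
by move=> z Oz _ [s _ <-].
Qed.

Definition path_space_set : set (B * paths) :=
  [set z | forall t, fp_proj Y (path_fun z.2 t) = z.1].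

Definition path_space : fpSpace B.
Proof.
refine (@fp_of_set B (B * paths)%type path_space_set fst
  (fun b => (b, const_path (fp_sec Y b))) _ _ _ _).
- exact: fst_cts.
- apply: pair_cts; first by move=> b; exact: cvg_id.
  exact: comp_cts (@fp_sec_cts _ Y) const_path_cts.
- by [].
- by move=> b t; exact: fp_secK.
Defined.

Definition ps_path (z : path_space) : paths := (set_val z).2.

Lemma ps_path_cts : continuous ps_path.
Proof. exact: comp_cts (@set_val_cts _ _) (@snd_cts _ _). Qed.

Lemma ps_pathE (z : path_space) t :
  fp_proj Y (path_fun (ps_path z) t) = fp_proj path_space z.
Proof. exact: (set_mem (valP z)). Qed.

Lemma endpoints_proof (z : path_space) : square_set
  (path_fun (ps_path z) I0, path_fun (ps_path z) I1).
Proof. by rewrite /square_set /= !ps_pathE. Qed.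

Definition endpoints_fun (z : path_space) : fp_square Y :=
  exist _ (path_fun (ps_path z) I0, path_fun (ps_path z) I1)
    (mem_set (endpoints_proof z)).

Lemma endpoints_cts : continuous endpoints_fun.
Proof.
apply: cts_to_subset; apply: pair_cts.
- exact: comp_cts ps_path_cts (@path_eval_cts I0).
- exact: comp_cts ps_path_cts (@path_eval_cts I1).
Qed.

Lemma endpoints_proj z :
  fp_proj (fp_square Y) (endpoints_fun z) = fp_proj path_space z.
Proof. exact: ps_pathE. Qed.

Lemma endpoints_sec b :
  endpoints_fun (fp_sec path_space b) = fp_sec (fp_square Y) b.
Proof. exact: eq_sig_hprop. Qed.

Definition endpoints : fpMap path_space (fp_square Y) :=
  FpMap endpoints_cts endpoints_proj endpoints_sec.
End PathSpace.

Section MapPair.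
Variables (B : topologicalType) (X Y : fpSpace B) (f g : fpMap X Y).

Lemma map_pair_proof x : square_set (f x, g x).
Proof. by rewrite /square_set /= !fp_fun_proj. Qed.

Definition map_pair_fun (x : X) : fp_square Y :=
  exist _ (f x, g x) (mem_set (map_pair_proof x)).

Lemma map_pair_cts : continuous map_pair_fun.
Proof.
apply: cts_to_subset.
exact: pair_cts (@fp_fun_cts _ _ _ f) (@fp_fun_cts _ _ _ g).
Qed.

Lemma map_pair_proj x : fp_proj (fp_square Y) (map_pair_fun x) = fp_proj X x.
Proof. exact: fp_fun_proj. Qed.

Lemma map_pair_sec b : map_pair_fun (fp_sec X b) = fp_sec (fp_square Y) b.
Proof. by apply: eq_sig_hprop => //=; rewrite !fp_fun_sec. Qed.

Definition fp_map_pair : fpMap X (fp_square Y) :=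
  FpMap map_pair_cts map_pair_proj map_pair_sec.
End MapPair.

Section Pullback.
Variables (B : topologicalType) (X P Z : fpSpace B).
Variables (u : fpMap X Z) (v : fpMap P Z).

Definition pullback_set : set (X * P) := [set w | u w.1 = v w.2].

Definition fp_pullback : fpSpace B.
Proof.
refine (@fp_of_set B (X * P)%type pullback_set (fun w => fp_proj X w.1)
  (fun b => (fp_sec X b, fp_sec P b)) _ _ _ _).
- exact: comp_cts (@fst_cts X P) (@fp_proj_cts _ X).
- exact: pair_cts (@fp_sec_cts _ X) (@fp_sec_cts _ P).
- by move=> b; exact: fp_secK.
- by move=> b; rewrite /pullback_set /= !fp_fun_sec.
Defined.

Definition pullback_fst_fun (w : fp_pullback) : X := (set_val w).1.

Lemma pullback_fst_cts : continuous pullback_fst_fun.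
Proof. exact: comp_cts (@set_val_cts _ _) (@fst_cts _ _). Qed.

Lemma pullback_fst_proj w :
  fp_proj X (pullback_fst_fun w) = fp_proj fp_pullback w.
Proof. by []. Qed.

Lemma pullback_fst_sec b : pullback_fst_fun (fp_sec fp_pullback b) = fp_sec X b.
Proof. by []. Qed.

Definition pullback_fst : fpMap fp_pullback X :=
  FpMap pullback_fst_cts pullback_fst_proj pullback_fst_sec.
End Pullback.

Section PathPullback.
Variables (RR : realType) (B : topologicalType) (X Y : fpSpace B).
Variables (f g : fpMap X Y).

Definition path_pullback : fpSpace B :=
  fp_pullback (fp_map_pair f g) (endpoints RR Y).

Definition path_pullback_proj : fpMap path_pullback X :=
  pullback_fst (fp_map_pair f g) (endpoints RR Y).

Lemma path_pullbackP (x : X) (z : path_space RR Y) :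
  pullback_set (fp_map_pair f g) (endpoints RR Y) (x, z) <->
  path_fun (ps_path z) I0 = f x /\ path_fun (ps_path z) I1 = g x.
Proof.
split => [/(congr1 (@set_val _ _)) [-> ->] //|[h0 h1]].
by apply: eq_sig_hprop => //=; rewrite h0 h1.
Qed.
End PathPullback.

Section StandardSimplex.
Variable RR : realType.

Definition std_simplex_set n : set 'rV[RR]_n.+1 :=
  [set x | (forall i, 0 <= x ord0 i) /\ \sum_i x ord0 i = 1].

Definition std_simplex n : topologicalType := @std_simplex_set n.

Variables (m n : nat) (f : 'I_m.+1 -> 'I_n.+1).

(* barycentric coordinates of the image of [x] under the affine map sending the
   vertex [i] to the vertex [f i] *)
Definition vertex_map_mx (x : 'rV[RR]_m.+1) : 'rV[RR]_n.+1 :=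
  \row_j \sum_(i | f i == j) x ord0 i.

Lemma vertex_map_proof (x : std_simplex m) :
  std_simplex_set (vertex_map_mx (set_val x)).
Proof.
have [x0 x1] := set_mem (valP x).
split => [j|]; first by rewrite mxE sumr_ge0.
rewrite -[RHS]x1 [RHS](partition_big f predT) //=.
by apply: eq_bigr => j _; rewrite mxE.
Qed.

Definition vertex_map (x : std_simplex m) : std_simplex n :=
  exist _ (vertex_map_mx (set_val x)) (mem_set (vertex_map_proof x)).

Lemma vertex_map_cts : continuous vertex_map.
Proof.
apply: continuous_comp_initial.
move=> x A /= [P HP PA]; rewrite nbhs_simpl /=.
have cj (j : 'I_n.+1) :
    \forall y \near x, P ord0 j (vertex_map_mx (set_val y) ord0 j).
  have := HP ord0 j.
  set h := fun y : std_simplex m => vertex_map_mx (set_val y) ord0 j.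
  suff hc : continuous h by exact: hc.
  have -> : h = fun y => \sum_(i | f i == j) (set_val y : 'rV_m.+1) ord0 i.
    by apply/funext => y; rewrite /h mxE.
  apply: continuous_big => [|i _ z].
    exact: add_continuous.
  apply: (@continuous_comp _ _ _ set_val (fun y : 'rV[RR]_m.+1 => y ord0 i)).
    exact: initial_continuous.
  exact: coord_continuous.
have : \forall y \near x, forall j, P ord0 j (vertex_map_mx (set_val y) ord0 j).
  exact: filter_forall cj.
by apply: filterS => y hy; apply: PA => i j; rewrite (ord1 i).
Qed.

HB.instance Definition _ := isContinuous.Build _ _ vertex_map vertex_map_cts.
End StandardSimplex.
Arguments vertex_map RR {m n} f x.

Lemma vertex_map_comp (RR : realType) m n q (f : 'I_m.+1 -> 'I_n.+1)
    (g : 'I_n.+1 -> 'I_q.+1) :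
  vertex_map RR g \o vertex_map RR f = vertex_map RR (g \o f).
Proof.
apply/funext => x; apply: eq_sig_hprop => //=; apply/rowP => k; rewrite !mxE.
rewrite [RHS](partition_big f (fun j => g j == k)) /=; last by move=> i.
apply: eq_bigr => j /eqP gj; rewrite mxE; apply: eq_bigl => i.
by case: (f i =P j) => [->|//]; rewrite ?gj ?eqxx ?andbF.
Qed.

Section SingularSimplices.
Variables (RR : realType) (X : topologicalType).

Definition sing n := continuousType (std_simplex RR n) X.

Definition sing_reindex m n (s : sing n) (f : 'I_m.+1 -> 'I_n.+1) : sing m :=
  (s \o vertex_map RR f : continuousType _ _).

Definition face n (s : sing n.+1) (i : 'I_n.+2) : sing n := sing_reindex s (lift i).

Definition front n (s : sing n) (p : 'I_n.+1) : sing p :=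
  sing_reindex s (widen_ord (ltn_ord p)).

Definition back n (s : sing n) (p : 'I_n.+1) : sing (n - p) :=
  sing_reindex s (fun i => inord (p + i)).

Definition simplices := {n : nat & sing n}.
Definition Simp n (s : sing n) : simplices := existT _ n s.

Definition simp_in (A : set X) n (s : sing n) : Prop := range s `<=` A.

Lemma sing_reindex_in (A : set X) m n (s : sing n) (f : 'I_m.+1 -> 'I_n.+1) :
  simp_in A s -> simp_in A (sing_reindex s f).
Proof. by move=> sA _ [x _ <-]; apply: sA; exists (vertex_map RR f x). Qed.

Lemma sing_reindexM m n q (s : sing q) (g : 'I_n.+1 -> 'I_q.+1)
    (f : 'I_m.+1 -> 'I_n.+1) :
  sing_reindex (sing_reindex s g) f = sing_reindex s (g \o f).
Proof.
apply/continuousEP => x; rewrite /sing_reindex /=.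
by rewrite -[in RHS]vertex_map_comp.
Qed.

Lemma eq_Simp m m' n (s : sing n) (f : 'I_m.+1 -> 'I_n.+1)
    (f' : 'I_m'.+1 -> 'I_n.+1) :
  m = m' ->
  (forall (i : 'I_m.+1) (i' : 'I_m'.+1), i = i' :> nat -> f i = f' i' :> nat) ->
  Simp (sing_reindex s f) = Simp (sing_reindex s f').
Proof.
move=> mm; subst m' => ff.
suff -> : f = f' by [].
by apply/funext => i; apply/val_inj; exact: ff.
Qed.
End SingularSimplices.

Section Cochains.
Variables (RR : realType) (X : topologicalType) (R : comPzRingType).

(* An element of the product over [n] of Hom(C_n(X), R), a homomorphism being
   determined by its values on singular simplices. [rel_cochain] below cuts out
   the direct sum over [n] of the relative cochain groups, so that [cohomology]
   is the direct sum of all H^n(X, A; R). *)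
Definition cochain : Type := simplices RR X -> R.
HB.instance Definition _ := GRing.Zmodule.on cochain.

Definition differential (c : cochain) : cochain := fun s =>
  let: existT n s := s in
  match n return sing RR X n -> R with
  | 0 => fun=> 0
  | m.+1 => fun s => \sum_(i < m.+2) (-1) ^+ i * c (Simp (face s i))
  end s.

(* front face times back face, summed over all bidegrees (p, n - p) *)
Definition cup_fun (a b : cochain) : cochain := fun s =>
  let: existT n s := s in
  \sum_(p < n.+1) a (Simp (front s p)) * b (Simp (back s p)).

Definition sign_fun (a : cochain) : cochain := fun s => (-1) ^+ tag s * a s.

Lemma differentialB a b : differential (a - b) = differential a - differential b.
Proof.
apply/funext => -[[|n] s] /=; first by rewrite [RHS]subrr.
transitivity (\sum_(i < n.+2) ((-1) ^+ i * a (Simp (face s i)) -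
                               (-1) ^+ i * b (Simp (face s i)))).
  by apply: eq_bigr => i _; rewrite -mulrBr.
by rewrite sumrB.
Qed.

Lemma cup_funBl a b c : cup_fun (a - b) c = cup_fun a c - cup_fun b c.
Proof.
apply/funext => -[n s] /=.
transitivity (\sum_(p < n.+1) (a (Simp (front s p)) * c (Simp (back s p)) -
                               b (Simp (front s p)) * c (Simp (back s p)))).
  by apply: eq_bigr => i _; rewrite -mulrBl.
by rewrite sumrB.
Qed.

Lemma cup_funBr a b c : cup_fun c (a - b) = cup_fun c a - cup_fun c b.
Proof.
apply/funext => -[n s] /=.
transitivity (\sum_(p < n.+1) (c (Simp (front s p)) * a (Simp (back s p)) -
                               c (Simp (front s p)) * b (Simp (back s p)))).
  by apply: eq_bigr => i _; rewrite -mulrBr.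
by rewrite sumrB.
Qed.

Lemma cup_fun0l c : cup_fun 0 c = 0.
Proof. by rewrite -(subrr 0) cup_funBl !subrr. Qed.

Lemma cup_fun0r c : cup_fun c 0 = 0.
Proof. by rewrite -(subrr 0) cup_funBr !subrr. Qed.

Lemma sign_funK a : sign_fun (sign_fun a) = a.
Proof. by apply/funext => s; rewrite /sign_fun mulrA -expr2 sqrr_sign mul1r. Qed.

Lemma differential_sign a :
  differential (sign_fun a) = - sign_fun (differential a).
Proof.
apply/funext => -[[|n] s].
  by rewrite -[RHS]/(- (_ * 0)) mulr0 oppr0.
rewrite -[RHS]/(- ((-1) ^+ n.+1 * _)) exprS mulN1r mulNr opprK /= mulr_sumr.
by apply: eq_bigr => i _; rewrite /sign_fun /= mulrCA.
Qed.

Lemma differential0 : differential 0 = 0.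
Proof. by rewrite -(subrr 0) differentialB !subrr. Qed.

Lemma differentialN a : differential (- a) = - differential a.
Proof. by rewrite -[- a]sub0r differentialB differential0 sub0r. Qed.

(* value of [c] on the restriction of [s] to the vertices f 0, ..., f k *)
Definition reval (c : cochain) n (s : sing RR X n) k (f : nat -> nat) : R :=
  c (Simp (sing_reindex s (fun i : 'I_k.+1 => inord (f i) : 'I_n.+1))).

Lemma eq_reval c n (s : sing RR X n) k f g :
  (forall i, (i <= k)%N -> f i = g i) -> reval c s k f = reval c s k g.
Proof.
move=> fg; congr (c _); apply: eq_Simp => // i i' ii'.
by rewrite ii' fg // -ltnS.
Qed.

Lemma reval_front c n (s : sing RR X n) p :
  c (Simp (front s p)) = reval c s p id.
Proof.
congr (c _); apply: eq_Simp => // i i' /= ii'.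
by rewrite ii' inordK // (leq_trans (ltn_ord i')).
Qed.

Lemma reval_back c n (s : sing RR X n) p :
  c (Simp (back s p)) = reval c s (n - p) (addn p).
Proof. by []. Qed.

Lemma bump_leq h k : (bump h k <= k.+1)%N.
Proof. by rewrite /bump; case: (h <= k)%N. Qed.

Lemma reval_face_front c n (s : sing RR X n.+1) i p :
  c (Simp (front (face s i) p)) = reval c s p (bump i).
Proof.
rewrite /front /face sing_reindexM; congr (c _); apply: eq_Simp => // j j' /= jj'.
rewrite jj' inordK // ltnS (leq_trans (bump_leq _ _)) //.
by rewrite (leq_trans (ltn_ord j')).
Qed.

Lemma reval_face_back c n (s : sing RR X n.+1) i p :
  c (Simp (back (face s i) p)) = reval c s (n - p) (fun j => bump i (p + j)).
Proof.
rewrite /back /face sing_reindexM; congr (c _); apply: eq_Simp => // j j' /= jj'.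
have pj : (p + j' < n.+1)%N.
  by rewrite ltnS -leq_subRL -1?ltnS // -ltnS ltn_ord.
by rewrite jj' !inordK // ltnS (leq_trans (bump_leq _ _)).
Qed.

Lemma reval_differential0 c n (s : sing RR X n) f :
  reval (differential c) s 0 f = 0.
Proof. by []. Qed.

Lemma reval_differential c n (s : sing RR X n) k f :
  reval (differential c) s k.+1 f =
  \sum_(i < k.+2) (-1) ^+ i * reval c s k (fun j => f (bump i j)).
Proof.
rewrite /reval /differential /=; apply: eq_bigr => i _; congr (_ * _).
by rewrite /face sing_reindexM.
Qed.

Lemma cup_funE a b n (s : sing RR X n) :
  cup_fun a b (Simp s) =
  \sum_(p < n.+1) reval a s p id * reval b s (n - p) (addn p).
Proof. by apply: eq_bigr => p _; rewrite reval_front reval_back. Qed.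

Lemma leibniz a b : differential (cup_fun a b) =
  cup_fun (differential a) b + cup_fun (sign_fun a) (differential b).
Proof.
apply/funext => -[[|n] s].
  rewrite -[RHS]/(cup_fun (differential a) b (Simp s) +
    cup_fun (sign_fun a) (differential b) (Simp s)) !cup_funE !big_ord1.
  by rewrite !reval_differential0 mul0r mulr0 addr0.
rewrite -[RHS]/(cup_fun (differential a) b (Simp s) +
    cup_fun (sign_fun a) (differential b) (Simp s)) !cup_funE.
rewrite big_ord_recl reval_differential0 mul0r add0r.
rewrite [X in _ + X]big_ord_recr /= subnn reval_differential0 mulr0 addr0.
rewrite -big_split /=.
transitivity (\sum_(i < n.+2) \sum_(p < n.+1) (-1) ^+ i *
   (reval a s p (bump i) * reval b s (n - p) (fun j => bump i (p + j)))).
  apply: eq_bigr => i _; rewrite mulr_sumr; apply: eq_bigr => p _.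
  by rewrite reval_face_front reval_face_back.
rewrite exchange_big /=; apply: eq_bigr => -[p /= pn] _.
rewrite /bump leq0n add1n subSS subSn // reval_differential.
have -> : reval (sign_fun a) s p id = (-1) ^+ p * reval a s p id by [].
rewrite reval_differential.
pose T i := (-1) ^+ i *
  (reval a s p (bump i) * reval b s (n - p) (fun j => bump i (p + j))).
pose U i := ((-1) ^+ i * reval a s p (bump i)) * reval b s (n - p) (addn p.+1).
pose V j := (-1) ^+ p * reval a s p id *
  ((-1) ^+ j * reval b s (n - p) (fun k => p + bump j k)%N).
rewrite mulr_suml mulr_sumr.
transitivity (\sum_(0 <= i < n.+2) T i); first by rewrite big_mkord.
transitivity (\sum_(0 <= i < p.+2) U i + \sum_(0 <= j < (n - p).+2) V j); last first.
  by rewrite !big_mkord.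
rewrite (@big_cat_nat _ _ _ p.+1) //=; last by rewrite ltnW.
rewrite [X in _ = X + _]big_nat_recr //= [X in _ = _ + X]big_nat_recl //=.
have UV : U p.+1 + V 0%N = 0.
  rewrite /U /V expr0 mul1r.
  rewrite (@eq_reval a _ s p (bump p.+1) id); last first.
    by move=> i ip; rewrite /bump ltnNge ip.
  rewrite (@eq_reval b _ s (n - p) (addn p.+1) (fun k => p + bump 0 k)%N).
    by rewrite exprS !mulN1r !mulNr addNr.
  by move=> i _; rewrite /bump leq0n addnA addn1.
rewrite -addrA [U p.+1 + _]addrA UV add0r; congr (_ + _).
  rewrite !big_mkord; apply: eq_bigr => -[i /= ip] _.
  rewrite /T /U mulrA; congr (_ * _); apply: eq_reval => j _.
  by rewrite /bump (leq_trans _ (leq_addr _ _)) //.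
rewrite -{1}[p.+1]add0n big_addn subSS subSn //.
rewrite !big_mkord; apply: eq_bigr => -[j /= jn] _; rewrite /T /V.
have -> : (j + p.+1)%N = (j.+1 + p)%N by rewrite addSnnS.
rewrite (@eq_reval a _ s p (bump (j.+1 + p)) id); last first.
  by move=> i ip; rewrite /bump ltnNge (leq_trans ip (leq_addl _ _)).
rewrite (@eq_reval b _ s (n - p) _ (fun k => p + bump j.+1 k)%N); last first.
  by move=> k _; rewrite /bump addnCA [(j.+1 + p)%N]addnC leq_add2l.
rewrite exprD; ring.
Qed.
End Cochains.

Section RelativeCohomology.
Variables (RR : realType) (R : comPzRingType).
Variables (X : topologicalType) (A : set X).
Local Notation cochain := (cochain RR X R).

Definition rel_cochain (c : cochain) : Prop :=
  (forall n (s : sing RR X n), simp_in A s -> c (Simp s) = 0) /\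
  exists N, forall n (s : sing RR X n), (N <= n)%N -> c (Simp s) = 0.

Lemma rel_cochain0 : rel_cochain 0.
Proof. by split=> //; exists 0%N. Qed.

Lemma rel_cochainB a b : rel_cochain a -> rel_cochain b -> rel_cochain (a - b).
Proof.
have E n (s : sing RR X n) : (a - b) (Simp s) = a (Simp s) - b (Simp s) by [].
move=> [aA [M aM]] [bA [N bN]]; split=> [n s sA|].
  by rewrite E aA // bA // subrr.
by exists (M + N)%N => n s MNn; rewrite E aM ?bN ?subrr //;
   apply: leq_trans MNn; rewrite ?leq_addr ?leq_addl.
Qed.

Lemma rel_cochain_sign a : rel_cochain a -> rel_cochain (sign_fun a).
Proof.
have E n (s : sing RR X n) : sign_fun a (Simp s) = (-1) ^+ n * a (Simp s) by [].
move=> [aA [M aM]]; split=> [n s sA|]; first by rewrite E aA // mulr0.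
by exists M => n s Mn; rewrite E aM // mulr0.
Qed.

Lemma rel_cochain_differential a : rel_cochain a -> rel_cochain (differential a).
Proof.
move=> [aA [M aM]]; split=> [[|n] s sA|] //=.
  rewrite big1 // => i _; rewrite aA ?mulr0 //; exact: sing_reindex_in.
exists M.+1 => -[|n] s //= Mn; rewrite big1 // => i _.
by rewrite aM // mulr0.
Qed.

Lemma rel_cochain_cup a b :
  rel_cochain a -> rel_cochain b -> rel_cochain (cup_fun a b).
Proof.
move=> [aA [M aM]] [bA [N bN]]; split=> [n s sA|].
  by rewrite /= big1 // => p _; rewrite aA ?mul0r //; exact: sing_reindex_in.
exists (M + N)%N => n s MNn; rewrite /= big1 // => p _.
have [Mp|pM] := leqP M p; first by rewrite aM // mul0r.
rewrite bN ?mulr0 // leq_subRL; last by rewrite -ltnS.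
by rewrite (leq_trans _ MNn) // leq_add2r ltnW.
Qed.

Definition cocycle : {pred cochain} :=
  fun c => `[< rel_cochain c /\ differential c = 0 >].

Lemma cocycleP c : reflect (rel_cochain c /\ differential c = 0) (c \in cocycle).
Proof. exact: asboolP. Qed.

Lemma cocycle_closed : zmod_closed cocycle.
Proof.
split; first by apply/cocycleP; split; [exact: rel_cochain0|exact: differential0].
move=> a b /cocycleP[ra da] /cocycleP[rb db]; apply/cocycleP; split.
  exact: rel_cochainB.
by rewrite differentialB da db subrr.
Qed.
HB.instance Definition _ := GRing.isZmodClosed.Build cochain cocycle cocycle_closed.

Record cocycles := Cocycle { cocycle_val : cochain ; _ : cocycle_val \in cocycle }.
HB.instance Definition _ := [isSub for cocycle_val].
HB.instance Definition _ := [Choice of cocycles by <:].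
HB.instance Definition _ := [SubChoice_isSubZmodule of cocycles by <:].

Definition coboundary : {pred cocycles} :=
  fun z => `[< exists2 b, rel_cochain b & \val z = differential b >].

Lemma coboundaryP z : reflect
  (exists2 b, rel_cochain b & \val z = differential b) (z \in coboundary).
Proof. exact: asboolP. Qed.

Lemma coboundary_closed : zmod_closed coboundary.
Proof.
split.
  by apply/coboundaryP; exists 0; [exact: rel_cochain0|rewrite differential0].
move=> z t /coboundaryP[a ra za] /coboundaryP[b rb tb]; apply/coboundaryP.
exists (a - b); first exact: rel_cochainB.
by rewrite raddfB /= za tb differentialB.
Qed.
HB.instance Definition _ :=
  GRing.isZmodClosed.Build cocycles coboundary coboundary_closed.

Definition cohomology : zmodType := Quotient.quot coboundary.
Definition coh_class (z : cocycles) : cohomology :=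
  (\pi_(Quotient.quot coboundary) z)%qT.

Lemma cup_cocycle_proof (z t : cocycles) :
  cup_fun (\val z) (\val t) \in cocycle.
Proof.
have [rz dz] := cocycleP _ (valP z); have [rt dt] := cocycleP _ (valP t).
apply/cocycleP; split; first exact: rel_cochain_cup.
by rewrite leibniz dz dt cup_fun0l cup_fun0r addr0.
Qed.
Definition cup_cocycle (z t : cocycles) : cocycles :=
  Cocycle (cup_cocycle_proof z t).

Definition cup (x y : cohomology) : cohomology :=
  coh_class (cup_cocycle (repr x) (repr y)).

Lemma coh_classP z t : coh_class z = coh_class t <-> z - t \in coboundary.
Proof. by rewrite Quotient.idealrBE; split=> [/eqP|/eqP]. Qed.

Lemma repr_coh_class z : repr (coh_class z) - z \in coboundary.
Proof. by apply/coh_classP; rewrite /coh_class reprK. Qed.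

(* [cup] does not depend on the chosen representatives *)
Lemma cup_coh_class z t :
  cup (coh_class z) (coh_class t) = coh_class (cup_cocycle z t).
Proof.
have /coboundaryP[a ra za] := repr_coh_class z.
have /coboundaryP[b rb tb] := repr_coh_class t.
rewrite /cup; move: (repr (coh_class z)) (repr (coh_class t)) za tb => z' t'.
rewrite !raddfB /= => za tb; apply/coh_classP/coboundaryP.
have [rz' dz'] := cocycleP _ (valP z'); have [rt dt] := cocycleP _ (valP t).
exists (cup_fun a (\val t) - cup_fun (sign_fun (\val z')) (- b)).
  apply: rel_cochainB; apply: rel_cochain_cup => //; first exact: rel_cochain_sign.
  by rewrite -sub0r; exact: rel_cochainB rel_cochain0 rb.
rewrite raddfB /= differentialB !leibniz dt cup_fun0r addr0 -za.
rewrite differential_sign dz'.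
have -> : sign_fun 0 = 0 :> cochain by apply/funext => s; exact: mulr0.
rewrite oppr0 cup_fun0l add0r sign_funK differentialN -tb.
by rewrite opprB cup_funBl cup_funBr opprB [RHS]addrC subrKA.
Qed.
End RelativeCohomology.

Section Induced.
Variables (RR : realType) (R : comPzRingType) (X Y : topologicalType).
Variables (A : set X) (C : set Y) (f : X -> Y).
Hypotheses (f_cts : continuous f) (fAC : forall x, A x -> C (f x)).

Definition sing_push n (s : sing RR X n) : sing RR Y n :=
  (mkcts f_cts \o s : continuousType _ _).

Definition cochain_pull (c : cochain RR Y R) : cochain RR X R :=
  fun s => c (Simp (sing_push (tagged s))).

Lemma rel_cochain_pull c : rel_cochain C c -> rel_cochain A (cochain_pull c).
Proof.
move=> [cC [N cN]]; split=> [n s sA|]; last by exists N => n s; exact: cN.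
by apply: cC => _ [x _ <-] /=; apply: fAC; apply: sA; exists x.
Qed.

Lemma differential_pull c : differential (cochain_pull c) = cochain_pull (differential c).
Proof.
apply/funext => -[[|n] s] //=; apply: eq_bigr => i _.
rewrite /cochain_pull /=; congr (_ * c (Simp _)); exact/continuousEP.
Qed.

Lemma pullB a b : cochain_pull (a - b) = cochain_pull a - cochain_pull b.
Proof. by []. Qed.

Lemma pull_cocycle_proof (z : cocycles RR R C) : cochain_pull (\val z) \in cocycle A.
Proof.
have [rz dz] := cocycleP _ _ (valP z); apply/cocycleP; split.
  exact: rel_cochain_pull.
by rewrite differential_pull dz.
Qed.
Definition pull_cocycle (z : cocycles RR R C) : cocycles RR R A :=
  Cocycle (pull_cocycle_proof z).

Definition coh_map (x : cohomology RR R C) : cohomology RR R A :=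
  coh_class (pull_cocycle (repr x)).

(* [coh_map] does not depend on the chosen representative *)
Lemma coh_map_coh_class z : coh_map (coh_class z) = coh_class (pull_cocycle z).
Proof.
have /coboundaryP[a ra za] := repr_coh_class z.
apply/coh_classP/coboundaryP; exists (cochain_pull a); first exact: rel_cochain_pull.
by rewrite raddfB /= differential_pull -za raddfB.
Qed.
End Induced.

Section FibrewiseCohomology.
Variables (RR : realType) (R : comPzRingType) (B : topologicalType).

Definition fp_cohomology (X : fpSpace B) : zmodType :=
  cohomology RR R (range (fp_sec X)).

Lemma fp_map_range (X Y : fpSpace B) (f : fpMap X Y) x :
  range (fp_sec X) x -> range (fp_sec Y) (f x).
Proof. by move=> [b _ <-]; exists b => //; rewrite fp_fun_sec. Qed.

Definition fp_induced (X Y : fpSpace B) (f : fpMap X Y) :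
    fp_cohomology Y -> fp_cohomology X :=
  coh_map (@fp_fun_cts _ _ _ f) (@fp_map_range _ _ f).

Definition fp_kernel (X Y : fpSpace B) (f : fpMap X Y) :
    set (fp_cohomology Y) :=
  [set x | fp_induced f x = 0].
End FibrewiseCohomology.
Arguments fp_induced RR R {B X Y} f _.
Arguments fp_kernel RR R {B X Y} f _.

Section Nilpotency.
Variables (RR : realType) (R : comPzRingType).
Variables (X : topologicalType) (A : set X).
Local Notation H := (cohomology RR R A).

(* [cup_upto u n] is the product of the [n + 1] classes [u 0, ..., u n] *)
Fixpoint cup_upto (u : nat -> H) (n : nat) : H :=
  if n is m.+1 then cup (cup_upto u m) (u n) else u 0%N.

Definition nilpotency (J : set H) : \bar int :=
  least [set n : nat | forall u : nat -> H,
    (forall i, (i <= n)%N -> J (u i)) -> cup_upto u n = 0].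
End Nilpotency.

(* Main.v *)
Require Import Defs.
From HB Require Import structures.
From mathcomp Require Import all_boot all_order all_algebra.
From mathcomp Require Import generic_quotient ring_quotient.
From mathcomp Require Import all_classical all_reals all_analysis.

Set Implicit Arguments.
Unset Strict Implicit.
Unset Printing Implicit Defensive.

Import Order.TTheory GRing.Theory Num.Theory.
Import numFieldNormedType.Exports.

Local Open Scope classical_set_scope.
Local Open Scope ring_scope.

(** Let [U_0, ..., U_n] be an open cover realising the distance, with pointed
    homotopies [H_i] between the restrictions of [f] and [g]. By the exponential
    law, [x |-> (x, (p x, H_i (x, -)))] is a section over [U_i] of the projection
    of the path pullback, and it maps the points of the section of [X] to the
    section of the pullback ([track_section]). A class in the kernel of the
    projection therefore restricts to zero on [U_i]; subtracting the coboundary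
    of a cochain that extends a primitive found over [U_i], it is represented by
    a relative cocycle that vanishes on every simplex lying in [U_i]
    ([kernel_vanish_on]). Given [n + 1] such classes, the cup product of these
    cocycles vanishes on every simplex lying in some [U_i], because front and
    back faces stay in [U_i].

    What remains is the theorem on small simplices in dual form
    ([small_primitive]): a cocycle [z] that vanishes on all simplices contained
    in a member of an open cover is a coboundary. Let [S] be barycentric
    subdivision and [T] the prism operator, acting on cochains, so that
    [d T + T d = 1 - S] and [d S = S d]. Then
      [z - S^m z = d (sum_(j < m) S^j T z)]
    for every [m], and at a simplex [s] the term [S^m z] vanishes as soon as [m]
    is large enough, by compactness of the standard simplex and because
    subdivision shrinks the diameters of affine simplices of dimension at most
    [k] by the factor [1 - 1 / (k + 1)]. The exponent depends on [s]: with [depth s] the least sufficient one, the primitive is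
      [b s = sum_(j < depth s) (S^j T z) s],
    the faces of [s] having depth at most [depth s] and the terms beyond their
    depth being zero there. On a small simplex the depth is [0], so [b] vanishes
    on small simplices, in particular on those in the section of [X]: it is a
    relative cochain.

    Free modules of chains do not appear. The affine chains of a simplex are
    handled through the functions that they act on, a function [c] on sequences
    of points standing for its linear extension to formal sums of sequences. In
    this dual form, coning off with apex [b] is [fun t => c (b :: t)], and the
    usual identities follow by induction on the number of vertices. Including
    the empty sequence, that is, using the augmented complex, lets the
    identities hold in dimension zero without exception. *)

(** * Alternating sums over faces of sequences of points *)

Lemma subrACA (G : zmodType) (x y z t : G) : x - y - (z - t) = x - z - (y - t).
Proof. by rewrite [in LHS]opprD addrACA -opprD. Qed.

Section Boundary.
Variables (V : eqType) (G : zmodType).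
Implicit Types (c : seq V -> G) (s t : seq V).

(** The dual of the augmented boundary. The recursion is the cone formula
    [d (v s') = s' - v (d s')]; [face_sumE] gives the usual alternating sum. *)
Fixpoint face_sum c s : G :=
  if s is v :: s' then c s' - face_sum (fun t => c (v :: t)) s' else 0.

Lemma eq_face_sum c c' s :
    (forall t, subseq t s -> (size t).+1 = size s -> c t = c' t) ->
  face_sum c s = face_sum c' s.
Proof.
elim: s c c' => [//|v s IHs] c c' cc' /=.
congr (_ - _); first by apply: cc' => //; exact: subseq_cons.
by apply: IHs => t ts szt; apply: cc'; rewrite /= ?eqxx ?szt.
Qed.

Lemma face_sumB c c' s : face_sum (fun t => c t - c' t) s = face_sum c s - face_sum c' s.
Proof.
elim: s c c' => [|v s IHs] c c' /=; first by rewrite subr0.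
by rewrite IHs subrACA.
Qed.

Lemma face_sum0 s : face_sum (fun=> 0) s = 0.
Proof. by elim: s => //= v s ->; rewrite subr0. Qed.

Lemma face_sumK c s : face_sum (face_sum c) s = 0.
Proof.
elim: s c => [//|v s IHs] c /=.
by rewrite face_sumB IHs subr0 subrr.
Qed.
End Boundary.

Lemma face_sum_map (V W : eqType) (G : zmodType) (f : V -> W) (c : seq W -> G) s :
  face_sum (fun t => c (map f t)) s = face_sum c (map f s).
Proof. by elim: s c => //= v s IHs c; rewrite (IHs (fun t => c (f v :: t))). Qed.

(** * Barycentric subdivision and the prism operator *)

Section Subdivision.
Variables (V : eqType) (G : zmodType) (bary : seq V -> V).
Implicit Types (c : seq V -> G) (s t : seq V).

(** Dual to the recursive formulas [S s = b (S (d s))] and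
    [T s = b (s - T (d s))], where [b] is the barycenter of [s] and juxtaposition
    is coning; the fuel [n] is always the number of points. *)
Fixpoint subdiv_rec n c s : G :=
  if n is m.+1 then face_sum (subdiv_rec m (fun t => c (bary s :: t))) s else c s.

Fixpoint prism_rec n c s : G :=
  if n is m.+1
  then c (bary s :: s) - face_sum (prism_rec m (fun t => c (bary s :: t))) s else 0.

Definition subdiv c s := subdiv_rec (size s) c s.
Definition prism c s := prism_rec (size s) c s.

Lemma subdiv_cons c v s :
  subdiv c (v :: s) = face_sum (subdiv (fun t => c (bary (v :: s) :: t))) (v :: s).
Proof. by apply: eq_face_sum => t _ [szt]; rewrite /subdiv szt. Qed.

Lemma prism_cons c v s :
  prism c (v :: s) = c (bary (v :: s) :: v :: s) -
    face_sum (prism (fun t => c (bary (v :: s) :: t))) (v :: s).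
Proof. by congr (_ - _); apply: eq_face_sum => t _ [szt]; rewrite /prism szt. Qed.

(** Induction on the number of points, in the shape of the recursion of [subdiv]
    and [prism], whose inner calls are on codimension one faces. *)
Lemma face_ind (P : seq V -> Prop) :
    P [::] ->
    (forall v s, (forall t, subseq t (v :: s) -> (size t).+1 = size (v :: s) ->
      P t) -> P (v :: s)) ->
  forall s, P s.
Proof.
move=> P0 PS s; have [n] := ubnP (size s); elim: n s => // n IHn [//|v s] /= sn.
by apply: PS => t _ [szt]; apply: IHn; rewrite szt.
Qed.

Lemma subdivB c c' s : subdiv (fun t => c t - c' t) s = subdiv c s - subdiv c' s.
Proof.
elim/face_ind: s c c' => [//|v s IHs] c c'.
by rewrite !subdiv_cons -face_sumB; apply: eq_face_sum => t ts szt; rewrite IHs.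
Qed.

Lemma subdiv0 s : subdiv (fun=> 0 : G) s = 0.
Proof.
elim/face_ind: s => [//|v s IHs].
by rewrite subdiv_cons -[RHS](face_sum0 G (v :: s)); apply: eq_face_sum.
Qed.

Lemma prismB c c' s : prism (fun t => c t - c' t) s = prism c s - prism c' s.
Proof.
elim/face_ind: s c c' => [|v s IHs] c c'; first by rewrite /prism /= subr0.
rewrite !prism_cons [RHS]subrACA -face_sumB; congr (_ - _).
by apply: eq_face_sum => t ts szt; rewrite IHs.
Qed.

Lemma prism0 s : prism (fun=> 0 : G) s = 0.
Proof.
rewrite -[RHS](subrr (prism (fun=> 0) s)) -prismB.
by congr (prism _ s); apply/funext => t; rewrite subr0.
Qed.

(** By the cone formula [c s] splits off from [face_sum c (b :: s)]; the rest is
    by induction an iterated face sum, hence zero. *)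
Lemma subdiv_face_sum c s : subdiv (face_sum c) s = face_sum (subdiv c) s.
Proof.
elim/face_ind: s c => [//|v s IHs] c; rewrite subdiv_cons.
rewrite (_ : (fun t => _) = fun t => c t - face_sum (fun r => c (bary (v :: s) :: r)) t) //.
set cb := fun t => c (_ :: t).
transitivity (face_sum (fun t => subdiv c t - face_sum (subdiv cb) t) (v :: s)).
  by apply: eq_face_sum => t ts szt; rewrite subdivB IHs.
by rewrite face_sumB face_sumK subr0.
Qed.

(** [prism] is a homotopy from [subdiv] to the identity. Expanding
    [prism (face_sum c)] by the cone formula, the induction hypothesis on the
    faces turns the correction term into [subdiv c], up to an iterated face sum. *)
Lemma face_sum_prism c s : face_sum (prism c) s + prism (face_sum c) s = c s - subdiv c s.
Proof.
elim/face_ind: s c => [|v s IHs] c; first by rewrite /prism /subdiv /= subrr addr0.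
set cb := fun t => c (bary (v :: s) :: t).
have E : prism (face_sum c) (v :: s) = c (v :: s) - face_sum cb (v :: s) -
    face_sum (fun t => prism c t - prism (face_sum cb) t) (v :: s).
  by rewrite prism_cons; congr (_ - _); apply: eq_face_sum => t ts szt; rewrite -prismB.
have {}E : prism (face_sum c) (v :: s) = c (v :: s) - face_sum cb (v :: s) -
    face_sum (prism c) (v :: s) + face_sum (prism (face_sum cb)) (v :: s).
  by rewrite E face_sumB opprB addrA -addrAC addrA.
have F : face_sum (prism (face_sum cb)) (v :: s) = face_sum cb (v :: s) - subdiv c (v :: s).
  rewrite subdiv_cons -/cb -face_sumB -[RHS]subr0 -(face_sumK (prism cb) (v :: s)) -face_sumB.
  by apply: eq_face_sum => t ts szt; rewrite -IHs // addrAC subrr add0r.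
by rewrite E F addrC addrAC subrK addrA subrK.
Qed.
End Subdivision.

Section Naturality.
Variables (V W : eqType) (G : zmodType).
Variables (baryV : seq V -> V) (baryW : seq W -> W) (f : V -> W).
Hypothesis f_bary :
  forall v s, f (baryV (v :: s)) = baryW (map f (v :: s)).

Lemma subdiv_map (c : seq W -> G) s :
  subdiv baryV (fun t => c (map f t)) s = subdiv baryW c (map f s).
Proof.
elim/face_ind: s c => [//|v s IHs] c.
rewrite map_cons !subdiv_cons -map_cons -f_bary -face_sum_map.
by apply: eq_face_sum => t ts szt; rewrite -IHs.
Qed.

Lemma prism_map (c : seq W -> G) s :
  prism baryV (fun t => c (map f t)) s = prism baryW c (map f s).
Proof.
elim/face_ind: s c => [//|v s IHs] c.
rewrite map_cons !prism_cons -map_cons -f_bary -face_sum_map; congr (_ - _).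
by apply: eq_face_sum => t ts szt; rewrite -IHs.
Qed.
End Naturality.

(** * Affine singular simplices of the standard simplex *)

Section AffineSimplices.
Variable RR : realType.
Local Notation Delta := (std_simplex RR).

Lemma simplex_ge0 n (x : Delta n) i : 0 <= set_val x ord0 i.
Proof. by have [+ _] := set_mem (valP x). Qed.

Lemma simplex_sum1 n (x : Delta n) : \sum_i set_val x ord0 i = 1.
Proof. by have [_] := set_mem (valP x). Qed.

Lemma simplex_inj n (x y : Delta n) : set_val x = set_val y -> x = y.
Proof. exact: val_inj. Qed.

Lemma vertex_proof n (i : 'I_n.+1) :
  @std_simplex_set RR n (delta_mx ord0 i).
Proof.
split=> [j|]; first by rewrite mxE ler0n.
rewrite (bigD1 i) //= mxE !eqxx big1 ?addr0 // => j ji.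
by rewrite mxE (negbTE ji) andbF.
Qed.
Definition vertex n (i : 'I_n.+1) : Delta n := 
  exist _ (delta_mx ord0 i) (mem_set (vertex_proof i)).
Lemma vertexE n (i : 'I_n.+1) : set_val (vertex i) = delta_mx ord0 i.
Proof. by []. Qed.

Definition vertices n : seq (Delta n) := [seq vertex i | i <- enum 'I_n.+1].

(** The affine map sending the [i]-th vertex to the [i]-th entry of [s]. The number
    [k] is independent of [size s], so that no casts between dimensions arise;
    the map is the intended one when [size s = k.+1]. *)
Definition affine_mx n (s : seq (Delta n)) k (x : 'rV[RR]_k.+1) : 'rV[RR]_n.+1 :=
  \sum_(i < k.+1) x ord0 i *: set_val (nth (vertex ord0) s i).

Lemma affine_proof n (s : seq (Delta n)) k (x : Delta k) :
  std_simplex_set (affine_mx s (set_val x)).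
Proof.
split=> [j|].
  by rewrite summxE sumr_ge0 // => i _; rewrite mxE mulr_ge0 ?simplex_ge0.
under eq_bigr do rewrite summxE.
rewrite exchange_big /= -[RHS](simplex_sum1 x); apply: eq_bigr => i _.
under eq_bigr do rewrite mxE.
by rewrite -mulr_sumr simplex_sum1 mulr1.
Qed.

Definition affine n (s : seq (Delta n)) k (x : Delta k) : Delta n :=
  exist _ (affine_mx s (set_val x)) (mem_set (affine_proof s x)).

Lemma affineE n (s : seq (Delta n)) k (x : Delta k) : set_val (affine s x) =
  \sum_(i < k.+1) set_val x ord0 i *: set_val (nth (vertex ord0) s i).
Proof. by []. Qed.

Lemma affine_cts n (s : seq (Delta n)) k : continuous (@affine n s k).
Proof.
apply: cts_to_subset; apply: continuous_big => [|i _ x].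
  exact: add_continuous.
apply: (@continuousZr_tmp _ _ _ (fun x : Delta k => set_val x ord0 i)).
apply: (@continuous_comp _ _ _ set_val (fun y : 'rV[RR]_k.+1 => y ord0 i)).
  exact: initial_continuous.
exact: coord_continuous.
Qed.
HB.instance Definition _ n s k :=
  isContinuous.Build _ _ (@affine n s k) (@affine_cts n s k).

Lemma affineM n (s : seq (Delta n)) m (t : seq (Delta m)) k (x : Delta k) :
  size t = k.+1 -> affine s (affine t x) = affine (map (@affine n s m) t) x.
Proof.
move=> szt; apply: simplex_inj; rewrite !affineE.
under eq_bigr do rewrite summxE scaler_suml.
rewrite exchange_big /=; apply: eq_bigr => i _.
rewrite (nth_map (vertex ord0)) ?szt // affineE scaler_sumr.
by apply: eq_bigr => j _; rewrite mxE scalerA.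
Qed.

Lemma size_vertices n : size (vertices n) = n.+1.
Proof. by rewrite size_map size_enum_ord. Qed.

Lemma nth_vertices n (i : 'I_n.+1) v : nth v (vertices n) i = vertex i.
Proof.
by rewrite (nth_map ord0) ?size_enum_ord // nth_ord_enum.
Qed.

Lemma affine_vertices n (x : Delta n) : affine (vertices n) x = x.
Proof.
apply: simplex_inj; rewrite affineE [RHS]row_sum_delta.
by apply: eq_bigr => i _; rewrite nth_vertices.
Qed.

Lemma affine_vertex n (s : seq (Delta n)) k (i : 'I_k.+1) :
  affine s (vertex i) = nth (vertex ord0) s i.
Proof.
apply: simplex_inj; rewrite affineE (bigD1 i) //= vertexE mxE !eqxx scale1r.
by rewrite big1 ?addr0 // => j ji; rewrite mxE (negbTE ji) andbF scale0r.
Qed.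

Lemma map_affine_vertices n (s : seq (Delta n)) k :
  size s = k.+1 -> map (@affine n s k) (vertices k) = s.
Proof.
move=> szs; apply: (@eq_from_nth _ (vertex ord0)) => [|i].
  by rewrite size_map size_vertices.
rewrite size_map size_vertices => ik.
rewrite (nth_map (vertex ord0)) ?size_vertices //.
by rewrite (nth_vertices (Ordinal ik)) affine_vertex.
Qed.

Lemma vertex_mapE m n (f : 'I_m.+1 -> 'I_n.+1) (x : Delta m) :
  vertex_map RR f x = affine [seq vertex (f i) | i <- enum 'I_m.+1] x.
Proof.
apply: simplex_inj; apply/rowP => j; rewrite affineE mxE summxE.
rewrite big_mkcond; apply: eq_bigr => i _; rewrite mxE.
rewrite (nth_map ord0) ?size_enum_ord // nth_ord_enum vertexE mxE eqxx /= eq_sym.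
by case: eqP; rewrite ?mulr1 ?mulr0.
Qed.

Lemma barycenter_proof k : @std_simplex_set RR k (const_mx k.+1%:R^-1).
Proof.
split=> [i|]; first by rewrite mxE invr_ge0 ler0n.
under eq_bigr do rewrite mxE.
by rewrite sumr_const card_ord -(mulr_natr (_^-1)) mulVf // pnatr_eq0.
Qed.
Definition barycenter k : Delta k := 
  exist _ (const_mx k.+1%:R^-1) (mem_set (barycenter_proof k)).

Definition bary n (s : seq (Delta n)) : Delta n := affine s (barycenter (size s).-1).

(** Naturality of barycenters under affine maps, which makes subdivision natural. *)
Lemma affine_bary n (s : seq (Delta n)) k v (t : seq (Delta k)) :
  affine s (bary (v :: t)) = bary (map (@affine n s k) (v :: t)).
Proof. by rewrite /bary affineM //= size_map. Qed.
End AffineSimplices.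

(** * Subdivision of singular cochains *)

Section LocalCochain.
Variables (RR : realType) (X : topologicalType) (R : comPzRingType).
Local Notation Delta := (std_simplex RR).
Implicit Type c : cochain RR X R.

Definition affine_sing n (sigma : sing RR X n) (s : seq (Delta n)) k : sing RR X k :=
  (sigma \o @affine RR n s k : continuousType _ _).

(** The pullback of [c] along [sigma] to the affine simplices of the standard
    simplex. The value [0] at the empty sequence makes the differential, which
    is zero in degree zero, agree with [face_sum] there too
    ([on_differential]). *)
Definition on_seqs c n (sigma : sing RR X n) (s : seq (Delta n)) : R :=
  if s is _ :: s' then c (Simp (affine_sing sigma s (size s'))) else 0.

Lemma on_seqsE c n (sigma : sing RR X n) s k : size s = k.+1 ->
  on_seqs c sigma s = c (Simp (affine_sing sigma s k)).
Proof. by case: s => //= v s [<-]. Qed.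

(** The affine simplex on all vertices is the identity, so a cochain is determined
    by its pullbacks [on_seqs]; identities between operators on cochains thus
    reduce to sequences of points. *)
Lemma on_vertices c n (sigma : sing RR X n) :
  on_seqs c sigma (vertices RR n) = c (Simp sigma).
Proof.
rewrite (@on_seqsE _ _ _ _ n) ?size_vertices //; congr (c (Simp _)).
by apply/continuousEP => x; rewrite /= affine_vertices.
Qed.

Lemma on_affine c n (sigma : sing RR X n) (s : seq (Delta n)) k (t : seq (Delta k)) :
  on_seqs c (affine_sing sigma s k) t = on_seqs c sigma (map (@affine RR n s k) t).
Proof.
case: t => //= v t; rewrite size_map; congr (c (Simp _)).
by apply/continuousEP => x; rewrite /= affineM.
Qed.

Lemma face_sumE (V : eqType) (c : seq V -> R) s :
  face_sum c s = \sum_(i < size s) (-1) ^+ i * c (take i s ++ drop i.+1 s).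
Proof.
elim: s c => [|v s IHs] c; first by rewrite big_ord0.
rewrite /= IHs big_ord_recl expr0 mul1r drop0; congr (_ + _).
by rewrite -sumrN; apply: eq_bigr => i _; rewrite exprS mulN1r mulNr.
Qed.

Lemma face_affine n (sigma : sing RR X n) s k (i : 'I_k.+2) : size s = k.+2 ->
  face (affine_sing sigma s k.+1) i =
  affine_sing sigma (take i s ++ drop i.+1 s) k.
Proof.
move=> szs; have i_s : (i <= size s)%N by rewrite szs ltnW.
apply/continuousEP => x; rewrite /= vertex_mapE affineM; last first.
  by rewrite size_map size_enum_ord.
congr (sigma (affine _ x)); apply: (@eq_from_nth _ (vertex RR ord0)) => [|j].
  rewrite 2!size_map size_enum_ord size_cat size_drop size_takel // szs.
  by rewrite subSS subnKC // -ltnS.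
rewrite 2!size_map size_enum_ord => jk.
rewrite -map_comp (nth_map ord0) ?size_enum_ord //=.
rewrite affine_vertex /= nth_enum_ord // nth_cat size_takel //.
rewrite /bump; case: leqP => ij; last by rewrite nth_take.
by rewrite nth_drop add1n addSn subnKC.
Qed.

Lemma on_differential c n (sigma : sing RR X n) s :
  on_seqs (differential c) sigma s = face_sum (on_seqs c sigma) s.
Proof.
case: s => [//|v [|w s]]; first by rewrite /= subrr.
rewrite face_sumE (@on_seqsE _ _ _ _ (size s).+1) //; apply: eq_bigr => i _.
rewrite face_affine // (@on_seqsE _ _ _ _ (size s)) //.
rewrite size_cat size_drop /= size_takel 1?ltnW //=.
by rewrite subSS subnKC // -ltnS.
Qed.

Definition subdivide c : cochain RR X R :=
  fun s => subdiv (@bary RR (tag s)) (on_seqs c (tagged s)) (vertices RR (tag s)).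

Definition prism_cochain c : cochain RR X R :=
  fun s => prism (@bary RR (tag s)) (on_seqs c (tagged s)) (vertices RR (tag s)).

(** Naturality: subdividing a cochain and then restricting it to affine simplices
    is subdivision on sequences. Hence iterating [subdivide] amounts to iterating
    [subdiv] within one fixed standard simplex. *)
Lemma on_subdivide c n (sigma : sing RR X n) s :
  on_seqs (subdivide c) sigma s = subdiv (@bary RR n) (on_seqs c sigma) s.
Proof.
case: s => [//|v s]; rewrite /= /subdivide /=.
rewrite (_ : on_seqs c (affine_sing _ _ _) = fun t =>
  on_seqs c sigma (map (@affine _ n (v :: s) (size s)) t)); last first.
  by apply/funext => t; rewrite on_affine.
by rewrite (subdiv_map (@affine_bary _ _ _ _)) map_affine_vertices.
Qed.

Lemma on_prism c n (sigma : sing RR X n) s :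
  on_seqs (prism_cochain c) sigma s = prism (@bary RR n) (on_seqs c sigma) s.
Proof.
case: s => [//|v s]; rewrite /= /prism_cochain /=.
rewrite (_ : on_seqs c (affine_sing _ _ _) = fun t =>
  on_seqs c sigma (map (@affine _ n (v :: s) (size s)) t)); last first.
  by apply/funext => t; rewrite on_affine.
by rewrite (prism_map (@affine_bary _ _ _ _)) map_affine_vertices.
Qed.

Lemma differential_subdivide c :
  differential (subdivide c) = subdivide (differential c).
Proof.
apply/funext => -[n sigma].
rewrite -[LHS](on_vertices _ sigma) -[RHS](on_vertices _ sigma).
rewrite on_differential on_subdivide.
rewrite (_ : on_seqs (differential c) sigma = face_sum (on_seqs c sigma)); last first.
  by apply/funext => t; rewrite on_differential.
by rewrite subdiv_face_sum; apply: eq_face_sum => t _ _; rewrite on_subdivide.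
Qed.

Lemma differential_prism c :
  differential (prism_cochain c) + prism_cochain (differential c) =
  c - subdivide c.
Proof.
apply/funext => -[n sigma].
transitivity (on_seqs (differential (prism_cochain c)) sigma (vertices RR n) +
    on_seqs (prism_cochain (differential c)) sigma (vertices RR n)).
  by rewrite !on_vertices.
transitivity (on_seqs c sigma (vertices RR n) -
    on_seqs (subdivide c) sigma (vertices RR n)); last by rewrite !on_vertices.
rewrite on_differential !on_subdivide on_prism -face_sum_prism; congr (_ + _).
  by apply: eq_face_sum => t _ _; rewrite on_prism.
by congr (prism _ _ _); apply/funext => t; rewrite on_differential.
Qed.
End LocalCochain.
Arguments subdivide {RR X R} c.

(** * Diameters of subdivided simplices *)

Section SimplexMetric.
Variables (RR : realType) (n : nat).
Local Notation Delta := (std_simplex RR).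
Implicit Types (s t : seq (Delta n)) (p : 'rV[RR]_n.+1).

Lemma simplex_le1 (x : Delta n) i : set_val x ord0 i <= 1.
Proof.
rewrite -(simplex_sum1 x) (bigD1 i) //= lerDl sumr_ge0 // => j _.
exact: simplex_ge0.
Qed.

Lemma norm_simplex_le1 (x : Delta n) : `|set_val x| <= 1.
Proof.
rewrite /Num.norm /= mx_normrE; apply: bigmax_le => // -[i j] _ /=.
by rewrite (ord1 i) ger0_norm ?simplex_ge0 ?simplex_le1.
Qed.

Lemma compact_simplex : compact (@std_simplex_set RR n).
Proof.
apply: bounded_closed_compact.
  exists 1; split; first exact: num_real.
  move=> M M1 x Dx; have := norm_simplex_le1 (exist _ x (mem_set Dx)).
  by move/le_trans; apply; exact: ltW.
have -> : @std_simplex_set RR n =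
    (\bigcap_i [set x : 'rV[RR]_n.+1 | 0 <= x ord0 i]) `&`
    [set x : 'rV[RR]_n.+1 | \sum_i x ord0 i = 1].
  by apply/seteqP; split=> x /= [x0 x1]; split=> // i; [move=> _|]; exact: x0.
apply: closedI.
  apply: closed_bigI => i _; apply: (@preimage_closed _ _
    (fun x : 'rV[RR]_n.+1 => x ord0 i) [set y | 0 <= y]).
    by move=> x _; exact: coord_continuous.
  exact: closed_ge.
apply: (@preimage_closed _ _
  (fun x : 'rV[RR]_n.+1 => \sum_i x ord0 i) [set y | y = 1]).
  move=> x _; apply: continuous_big => [|i _]; first exact: add_continuous.
  exact: coord_continuous.
exact: closed_eq.
Qed.

(** The radius is uniform by compactness: near each point, half the radius of a
    ball contained in a member of the cover is good enough. *)
Lemma lebesgue_number (I : Type) (U : I -> set (Delta n)) :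
    (forall i, open (U i)) -> (forall x, exists i, U i x) ->
  exists2 e : RR, 0 < e & forall x : Delta n, exists i,
    forall y, `|set_val x - set_val y| < e -> U i y.
Proof.
move=> oU covU.
pose P (e : RR) (x' : 'rV[RR]_n.+1) :=
  exists i, forall y : Delta n, `|x' - set_val y| < e -> U i y.
have nearP : \forall e \near 0^'+, @std_simplex_set RR n `<=` P e.
  move/compact_near_coveringP : compact_simplex; apply=> x Dx.
  have [i Ux] := covU (exist _ x (mem_set Dx)).
  have [W oW WE] := oU i.
  have : nbhs x W by apply: open_nbhs_nbhs; split=> //; move: Ux; rewrite -WE.
  move=> /nbhs_normP[r /= r0 rW].
  have near_x : \forall z \near (x : 'rV[RR]_n.+1), `|x - z| < r / 2.
    by apply/nbhs_normP; exists (r / 2) => //=; rewrite divr_gt0.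
  near=> x' e; exists i => y /= x'y; rewrite -WE; apply: rW => /=.
  rewrite -(subrKA x') (le_lt_trans (ler_normD _ _)) // (splitr r) ltrD //.
    by near: x'; exact: near_x.
  rewrite (lt_trans x'y) //; near: e.
  by apply: nbhs_right_lt; rewrite divr_gt0.
have [e [e0 eP]] := filter_ex (filterI (nbhs_right_gt 0) nearP).
by exists e => // x; apply: eP; exact: set_mem (valP x).
Unshelve. all: by end_near.
Qed.

Lemma dist_affine p s k (x : Delta k) :
  `|p - set_val (affine s x)| <=
  \sum_(i < k.+1) set_val x ord0 i * `|p - set_val (nth (vertex RR ord0) s i)|.
Proof.
rewrite -{1}[p]scale1r -(simplex_sum1 x) affineE scaler_suml -sumrB.
apply: le_trans (ler_norm_sum _ _ _) _; apply: ler_sum => i _.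
by rewrite -scalerBr normrZ ger0_norm ?simplex_ge0.
Qed.

Definition in_ball p (r : RR) s := forall y, y \in s -> `|p - set_val y| <= r.
Definition diam_le (d : RR) s := forall x, x \in s -> in_ball (set_val x) d s.

Lemma in_ball_affine p r s k (x : Delta k) :
  size s = k.+1 -> in_ball p r s -> `|p - set_val (affine s x)| <= r.
Proof.
move=> szs sr; apply: le_trans (dist_affine _ _ _) _.
rewrite -[leRHS]mul1r -(simplex_sum1 x) mulr_suml; apply: ler_sum => i _.
by rewrite ler_wpM2l ?simplex_ge0 // sr // mem_nth ?szs.
Qed.

(** The distance from the barycenter to a vertex [y] is at most the weighted mean
    of the distances from [y] to all the vertices. The term of [y] itself is
    zero, and the other weights add up to [1 - 1 / size (v :: s)], which is at
    most [1 - 1 / (N + 1)]. *)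
Lemma bary_dist N d v s : (size s <= N)%N -> 0 <= d -> diam_le d (v :: s) ->
  in_ball (set_val (bary (v :: s))) ((1 - N.+1%:R^-1) * d) (v :: s).
Proof.
move=> sN d0 diam_s y ys; rewrite distrC; apply: le_trans (dist_affine _ _ _) _.
have [i ik yE] : exists2 i, (i < (size s).+1)%N & nth (vertex RR ord0) (v :: s) i = y.
  by exists (index y (v :: s)); rewrite ?nth_index // -[ltnRHS]/(size (v :: s)) index_mem.
rewrite (bigD1 (Ordinal ik)) //= yE subrr normr0 mulr0 add0r.
apply: (@le_trans _ _ (\sum_(j < (size s).+1 | j != Ordinal ik)
    set_val (barycenter RR (size s)) ord0 j * d)).
  apply: ler_sum => j _; rewrite ler_wpM2l ?simplex_ge0 //; apply: diam_s => //.
  by rewrite mem_nth /=.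
rewrite -mulr_suml ler_wpM2r //.
have := simplex_sum1 (barycenter RR (size s)); rewrite (bigD1 (Ordinal ik)) //=.
move/(congr1 (fun x => x - set_val (barycenter RR (size s)) ord0 (Ordinal ik))).
rewrite addrC addrK => ->; rewrite mxE lerD2l lerN2 lef_pV2 ?posrE ?ltr0n //.
by rewrite ler_nat.
Qed.
End SimplexMetric.

Section Mesh.
Variables (RR : realType) (n : nat) (G : zmodType) (N : nat).
Local Notation Delta := (std_simplex RR).
Local Notation q := (1 - N.+1%:R^-1 : RR).
Implicit Types (s t : seq (Delta n)) (c : seq (Delta n) -> G).

Lemma shrink_ge0 : 0 <= q.
Proof. by rewrite subr_ge0 invf_le1 ?ler1n ?ltr0n. Qed.

(** The simplices [t] of the subdivision of [s] consist of a barycenter followed by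
    a simplex of the subdivision of a face. That they lie in every ball
    containing [s] is carried through the induction: it bounds the distance from
    the barycenter of [s] to the remaining points of [t], knowing only its
    distance to the vertices of [s]. *)
Lemma subdiv_mesh d c s : 0 <= d -> (size s <= N.+1)%N -> diam_le d s ->
    (forall t, size t = size s -> (forall p r, in_ball p r s -> in_ball p r t) ->
      diam_le (q * d) t -> c t = 0) ->
  subdiv (@bary RR n) c s = 0.
Proof.
move=> d0; elim/face_ind: s c => [|v s IHs] c sN diam_s cP; first exact: cP.
rewrite subdiv_cons -[RHS](face_sum0 G (v :: s)); apply: eq_face_sum => t ts szt.
have sub p r : in_ball p r (v :: s) -> in_ball p r t.
  by move=> sr y /(mem_subseq ts); exact: sr.
apply: IHs => //; first by rewrite (leq_trans (ltnW _) sN) // szt.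
  by move=> x /(mem_subseq ts) xs; exact/sub/diam_s.
move=> u szu tu ud; apply: cP => [|p r sr y|x]; first by rewrite /= szu.
  rewrite inE => /predU1P[->|]; first exact: in_ball_affine.
  exact/tu/sub.
have bu : in_ball (set_val (bary (v :: s))) (q * d) u.
  by apply/tu/sub; exact: bary_dist.
rewrite inE => /predU1P[->|xu] y; rewrite inE => /predU1P[->|yu].
- by rewrite subrr normr0 mulr_ge0 ?shrink_ge0.
- exact: bu.
- by rewrite distrC; exact: bu.
- exact: ud.
Qed.

Lemma iter_subdiv_mesh m d c s : 0 <= d -> (size s <= N.+1)%N -> diam_le d s ->
    (forall t, (size t <= N.+1)%N -> diam_le (q ^+ m * d) t -> c t = 0) ->
  iter m (subdiv (@bary RR n)) c s = 0.
Proof.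
move=> d0; elim: m d d0 s => [|m IHm] d d0 s sN diam_s cP.
  by apply: cP => //; rewrite expr0 mul1r.
rewrite iterS; apply: (subdiv_mesh d0 sN diam_s) => // t szt _ td.
apply: (IHm _ _ _ _ td); rewrite ?szt ?mulr_ge0 ?shrink_ge0 // => u uN.
by rewrite mulrA -exprSr; exact: cP.
Qed.
End Mesh.

(** * Cocycles vanishing on small simplices *)

Section SmallSimplices.
Variables (RR : realType) (X : topologicalType) (R : comPzRingType).
Local Notation cochain := (cochain RR X R).
Implicit Type c : cochain.

Definition vanish_on (W : set X) c :=
  forall n (s : sing RR X n), simp_in W s -> c (Simp s) = 0.

Lemma on_seqs_vanish W c n (sigma : sing RR X n) :
  vanish_on W c -> simp_in W sigma -> on_seqs c sigma = fun=> 0.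
Proof.
move=> cW sW; apply/funext => -[//|v s]; apply: cW => _ [x _ <-] /=.
by apply: sW; eexists.
Qed.

Lemma vanish_subdivide W c : vanish_on W c -> vanish_on W (subdivide c).
Proof.
by move=> cW n s sW; rewrite /subdivide /= (on_seqs_vanish cW sW) subdiv0.
Qed.

Lemma vanish_prism W c : vanish_on W c -> vanish_on W (prism_cochain c).
Proof.
by move=> cW n s sW; rewrite /prism_cochain /= (on_seqs_vanish cW sW) prism0.
Qed.

Lemma vanish_iter_subdivide W m c :
  vanish_on W c -> vanish_on W (iter m subdivide c).
Proof. by move=> cW; elim: m => //= m; exact: vanish_subdivide. Qed.

Lemma subdivideB c c' : subdivide (c - c') = subdivide c - subdivide c'.
Proof.
apply/funext => -[n s]; rewrite -[RHS]/(_ (Simp s) - _ (Simp s)) /subdivide /=.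
rewrite -subdivB; congr (subdiv _ _ _).
by apply/funext => -[|v t] //=; rewrite subr0.
Qed.

Lemma iter_subdivideB m c c' :
  iter m subdivide (c - c') = iter m subdivide c - iter m subdivide c'.
Proof. by elim: m => //= m ->; rewrite subdivideB. Qed.

Lemma differential_iter m c :
  differential (iter m subdivide c) = iter m subdivide (differential c).
Proof. by elim: m => //= m <-; rewrite differential_subdivide. Qed.

Lemma on_iter_subdivide m c n (sigma : sing RR X n) :
  on_seqs (iter m subdivide c) sigma = iter m (subdiv (@bary RR n)) (on_seqs c sigma).
Proof.
by elim: m => //= m <-; apply/funext => s; rewrite on_subdivide.
Qed.

Lemma prism_cochain0 : prism_cochain 0 = 0 :> cochain.
Proof.
apply/funext => -[n s]; rewrite /prism_cochain -[RHS](prism0 _ (@bary RR n)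
  (vertices RR n)).
by congr (prism _ _ _); apply/funext => -[|v t].
Qed.

(** Telescoping of [d S^j T c = S^j c - S^(j+1) c], valid on cocycles. *)
Lemma sum_differential_prism m c : differential c = 0 ->
  \sum_(j < m) differential (iter j subdivide (prism_cochain c)) =
  c - iter m subdivide c.
Proof.
move=> dc; elim: m => [|m IHm]; first by rewrite big_ord0 subrr.
have dT : differential (prism_cochain c) = c - subdivide c.
  by rewrite -differential_prism dc prism_cochain0 addr0.
rewrite big_ord_recr IHm /= differential_iter dT iter_subdivideB -iterSr.
by rewrite addrA subrK.
Qed.

Section Cover.
Variables (I : Type) (U : I -> set X).
Hypotheses (U_open : forall i, open (U i)) (U_cover : forall x, exists i, U i x).

Definition small_vanish c := forall i, vanish_on (U i) c.

(** The [m]-th subdivision of [sigma] is made of small simplices, in dual form. All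
    affine simplices [s] of dimension at most that of [sigma] are considered,
    rather than [sigma] alone, so that the property passes to faces. *)
Definition fine (m : nat) (sigma : simplices RR X) := forall c, small_vanish c ->
  forall s, (size s <= (tag sigma).+1)%N ->
  on_seqs (iter m subdivide c) (tagged sigma) s = 0.

Lemma ex_fine sigma : exists m, fine m sigma.
Proof.
case: sigma => n s.
have [e e0 eP] : exists2 e : RR, 0 < e & forall x : std_simplex RR n, exists i,
    forall y, `|set_val x - set_val y| < e -> U i (s y).
  apply: (@lebesgue_number _ _ _ (fun i => s @^-1` U i)) => [i|x]; last exact: U_cover.
  by apply: open_comp => // x _; exact: cts_fun.
have q1 : `|1 - n.+1%:R^-1 : RR| < 1.
  by rewrite ger0_norm ?shrink_ge0 // ltrBlDr ltrDl invr_gt0 ltr0n.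
have [m /= mP] : exists m, (1 - n.+1%:R^-1) ^+ m < e / 2 :> RR.
  have e2 : 0 < e / 2 by rewrite divr_gt0.
  have [m _ /(_ m (leqnn m))] := cvgr0_norm_lt _ (cvg_expr q1) _ e2.
  by rewrite /= normrX ger0_norm ?shrink_ge0 //; exists m.
exists m => c cU t /= tn; rewrite on_iter_subdivide.
apply: (@iter_subdiv_mesh RR n R n m 2) => // [x _ y _|[//|x u] uN ud].
  rewrite (le_trans (ler_normB _ _)) // -[leRHS]/(1 + 1) lerD //; exact: norm_simplex_le1.
have [i iP] := eP x; rewrite (@on_seqsE _ _ _ _ _ _ _ (size u)) //.
apply: cU => _ [y _ <-] /=; apply: iP.
apply: (@le_lt_trans _ _ ((1 - n.+1%:R^-1) ^+ m * 2)); last by rewrite -ltr_pdivlMr.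
by apply: in_ball_affine => //; apply: ud; exact: mem_head.
Qed.

Lemma fine_face m n (s : sing RR X n.+1) i : fine m (Simp s) -> fine m (Simp (face s i)).
Proof.
move=> fs c cU t /= tn.
rewrite (_ : face s i = affine_sing s [seq vertex RR (lift i j) | j <- enum 'I_n.+1] n).
  by rewrite on_affine fs //= size_map ltnW.
by apply/continuousEP => x; rewrite /= vertex_mapE.
Qed.

Lemma fine0 n (s : sing RR X n) i : simp_in (U i) s -> fine 0 (Simp s).
Proof. by move=> si c cU t _ /=; rewrite (on_seqs_vanish (cU i) si). Qed.

Lemma fine_vanish m n (s : sing RR X n) c j :
  fine m (Simp s) -> small_vanish c -> (m <= j)%N -> iter j subdivide c (Simp s) = 0.
Proof.
move=> fs cU mj; rewrite -(subnKC mj) iterD -on_vertices fs //= ?size_vertices //.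
by move=> i; exact: vanish_iter_subdivide.
Qed.

(** The theorem of small simplices: the primitive is the sum of the [S^j T z] up to
    the least [m] that is fine for the simplex at hand. *)
Lemma small_primitive z : differential z = 0 -> small_vanish z ->
  exists2 b, small_vanish b & z = differential b.
Proof.
move=> dz zU.
have /choice[depth depthP] : forall s : simplices RR X,
    exists m, fine m s /\ forall k, fine k s -> (m <= k)%N.
  move=> s; have ex : exists m, `[< fine m s >].
    by have [m sm] := ex_fine s; exists m; apply/asboolP.
  case: (ex_minnP ex) => m /asboolP sm min_m; exists m; split=> // k sk.
  by apply: min_m; apply/asboolP.
pose h j := iter j subdivide (prism_cochain z).
pose b : cochain := fun s => \sum_(j < depth s) h j s.
exists b => [i n s si|].
  have := (depthP (Simp s)).2 _ (fine0 si); rewrite leqn0 => /eqP s0.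
  by rewrite /b s0 big_ord0.
apply/funext => -[n s].
have [s_fine s_min] := depthP (Simp s); set m := depth _ in s_fine s_min.
have sumE (F : nat -> cochain) : (\sum_(j < m) F j) (Simp s) = \sum_(j < m) F j (Simp s).
  by elim/big_rec2: _ => // j x y _ <-.
transitivity (\sum_(j < m) differential (h j) (Simp s)).
  rewrite -(sumE (fun j => differential (h j))) sum_differential_prism //.
  rewrite -[RHS]/(z (Simp s) - iter m subdivide z (Simp s)).
  by rewrite (fine_vanish s_fine) // subr0.
rewrite /m; case: n s @m s_fine s_min sumE => [|n] s m s_fine s_min _; first by rewrite big1.
rewrite exchange_big /=; apply: eq_bigr => i _; rewrite -mulr_sumr; congr (_ * _).
have [f_fine f_min] := depthP (Simp (face s i)).
(* A face needs no more subdivisions than [s]; on it, the terms from its own depth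
   up to that of [s] vanish. *)
rewrite [RHS](big_ord_widen _ (fun j => h j (Simp (face s i)))
  (f_min _ (fine_face s_fine))) [RHS]big_mkcond; apply: eq_bigr => j _.
case: ltnP => // le_j; rewrite /h (fine_vanish f_fine) // => k.
exact: vanish_prism (zU k).
Qed.
End Cover.
End SmallSimplices.

(** * Relative cohomology classes *)

Section RelativeClasses.
Variables (RR : realType) (R : comPzRingType) (X : topologicalType).
Implicit Types (a b c : cochain RR X R) (A W : set X).

Lemma differentialK c : differential (differential c) = 0.
Proof.
apply/funext => -[n s]; rewrite -on_vertices on_differential.
by rewrite -[RHS](face_sumK (on_seqs c s) (vertices RR n)); apply: eq_face_sum => t _ _;
   rewrite on_differential.
Qed.

Lemma vanish_cupl W a b : vanish_on W a -> vanish_on W (cup_fun a b).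
Proof.
move=> aW n s sW; rewrite /= big1 // => p _.
by rewrite aW ?mul0r //; exact: sing_reindex_in.
Qed.

Lemma vanish_cupr W a b : vanish_on W b -> vanish_on W (cup_fun a b).
Proof.
move=> bW n s sW; rewrite /= big1 // => p _.
by rewrite bW ?mulr0 //; exact: sing_reindex_in.
Qed.

Lemma coh_class_eq0 A (z : cocycles RR R A) :
  coh_class z = 0 <-> exists2 b, rel_cochain A b & \val z = differential b.
Proof.
have -> : 0 = coh_class (0 : cocycles RR R A) by rewrite /coh_class pi_zeror.
rewrite coh_classP subr0; split=> [/coboundaryP|] //.
by move=> ?; apply/coboundaryP.
Qed.

(** Relative cochains have bounded degree. A primitive may be cut off at a degree
    from which [c] is zero: this leaves its differential unchanged in lower
    degrees, and makes it zero in the degrees where [c] is. *)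
Lemma truncate_primitive A c b : rel_cochain A c -> vanish_on A b ->
  c = differential b -> exists2 b', rel_cochain A b' & c = differential b'.
Proof.
move=> [cA [N cN]] bA cb.
exists (fun s => if (tag s < N)%N then b s else 0).
  split=> [n s sA|]; first by case: ifP => // _; exact: bA.
  by exists N => n s Nn; rewrite /= ltnNge Nn.
apply/funext => -[[|n] s]; first by rewrite cb.
have [nN|Nn] := ltnP n N; first by rewrite cb /= nN.
rewrite cN 1?ltnW //= big1 // => i _.
by rewrite ltnNge Nn mulr0.
Qed.
End RelativeClasses.

(** * Classes killed by a map with a local section *)

Section LocalSection.
Variables (RR : realType) (R : comPzRingType) (X P : topologicalType).
Variables (A : set X) (C : set P) (pi : P -> X) (U : set X) (sec : U -> P).
Hypotheses (pi_cts : continuous pi) (pi_CA : forall y, C y -> A (pi y)).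
Hypotheses (sec_cts : continuous sec) (pi_sec : forall x, pi (sec x) = set_val x).
Hypothesis sec_AC : forall x, A (set_val x) -> C (sec x).

Section Lift.
Variables (n : nat) (s : sing RR X n) (sU : simp_in U s).

Definition corestrict (t : std_simplex RR n) : U :=
  exist _ (s t) (mem_set (sU (imageT s t))).

Lemma corestrict_cts : continuous corestrict.
Proof. by apply: cts_to_subset; exact: cts_fun. Qed.

Definition lift_sing : sing RR P n := mkcts (comp_cts corestrict_cts sec_cts).
End Lift.

Lemma face_lift n (s : sing RR X n.+1) (sU : simp_in U s) i
    (fU : simp_in U (face s i)) :
  face (lift_sing sU) i = lift_sing fU.
Proof.
by apply/continuousEP => t /=; congr (sec _); apply: val_inj.
Qed.

(** Extension by zero of the pullback of [b] along the local section; it commutes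
    with the differential on the simplices contained in [U]
    ([differential_extend]). *)
Definition extend_cochain (b : cochain RR P R) : cochain RR X R := fun s =>
  if pselect (simp_in U (tagged s)) is left sU then b (Simp (lift_sing sU)) else 0.

Lemma extend_cochainE b n (s : sing RR X n) (sU : simp_in U s) :
  extend_cochain b (Simp s) = b (Simp (lift_sing sU)).
Proof.
rewrite /extend_cochain /=; case: pselect => // sU'.
by congr (b (Simp (lift_sing _))); exact: Prop_irrelevance.
Qed.

Lemma differential_extend b n (s : sing RR X n) (sU : simp_in U s) :
  differential (extend_cochain b) (Simp s) = differential b (Simp (lift_sing sU)).
Proof.
case: n s sU => [//|n] s sU; apply: eq_bigr => i _; congr (_ * _).
have fU : simp_in U (face s i) by exact: sing_reindex_in.
by rewrite (extend_cochainE _ fU) face_lift.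
Qed.

Lemma rel_cochain_extend b : rel_cochain C b -> rel_cochain A (extend_cochain b).
Proof.
move=> [bC [N bN]]; split=> [n s sA|].
  rewrite /extend_cochain /=; case: pselect => // sU; apply: bC => _ [t _ <-] /=.
  by apply: sec_AC; apply: sA; exists t.
by exists N => n s Nn; rewrite /extend_cochain /=; case: pselect => // sU; exact: bN.
Qed.

(** If the pullback of a representative to [P] is the differential of [b], subtracting
    the differential of the extension of [b] makes it vanish on [U], since
    [pi \o sec] is the inclusion. *)
Lemma kernel_vanish_on (x : cohomology RR R A) :
    coh_map pi_cts pi_CA x = 0 ->
  exists2 z : cocycles RR R A, coh_class z = x & vanish_on U (\val z).
Proof.
move=> /coh_class_eq0[b bC zb].
have bA := rel_cochain_extend bC.
have dbP : differential (extend_cochain b) \in cocycle A.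
  apply/cocycleP; split; first exact: rel_cochain_differential.
  exact: differentialK.
exists (repr x - Cocycle dbP).
  rewrite -[RHS](reprK x); apply/esym/coh_classP/coboundaryP.
  by exists (extend_cochain b) => //; rewrite subKr.
move=> n s sU; rewrite raddfB.
rewrite -[LHS]/(\val (repr x) (Simp s) - differential (extend_cochain b) (Simp s)).
rewrite (differential_extend _ sU) -zb /= /cochain_pull /=.
rewrite (_ : sing_push _ _ = s) ?subrr //.
by apply/continuousEP => t; exact: pi_sec.
Qed.
End LocalSection.

(** * Fibrewise homotopies as local sections of the path pullback *)

Section PathSection.
Variables (RR : realType) (B : topologicalType) (X Y : fpSpace B).
Variables (f g : fpMap X Y) (U : set X) (secU : forall b, U (fp_sec X b)).
Local Notation UX := (fp_sub secU).
Variable H : UX * unit_interval RR -> Y.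
Hypotheses (H_cts : continuous H) (H0 : forall x, H (x, I0) = f (set_val x)).
Hypotheses (H1 : forall x, H (x, I1) = g (set_val x)).
Hypothesis H_proj : forall x t, fp_proj Y (H (x, t)) = fp_proj X (set_val x).
Hypothesis H_sec : forall b t, H (fp_sec UX b, t) = fp_sec Y b.

Definition track (x : UX) : paths RR Y :=
  mkcts ((continuous_curry H_cts).2 x).

Lemma track_cts : continuous track.
Proof.
by apply: continuous_comp_initial; exact: (continuous_curry H_cts).1.
Qed.

Lemma track_path_proof x : path_space_set (fp_proj X (set_val x), track x).
Proof. by move=> t; exact: H_proj. Qed.

Definition track_path (x : UX) : path_space RR Y :=
  exist _ (fp_proj X (set_val x), track x) (mem_set (track_path_proof x)).

Lemma track_path_cts : continuous track_path.
Proof.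
apply: cts_to_subset; apply: pair_cts; last exact: track_cts.
exact: (@fp_proj_cts _ UX).
Qed.

Lemma track_section_proof x :
  pullback_set (fp_map_pair f g) (endpoints RR Y) (set_val x, track_path x).
Proof. by apply/path_pullbackP; split; [exact: H0|exact: H1]. Qed.

Definition track_section (x : UX) : path_pullback RR f g :=
  exist _ (set_val x, track_path x) (mem_set (track_section_proof x)).

Lemma track_section_cts : continuous track_section.
Proof.
apply: cts_to_subset; apply: pair_cts; last exact: track_path_cts.
exact: set_val_cts.
Qed.

Lemma track_section_sec (x : UX) : range (fp_sec X) (set_val x) ->
  range (fp_sec (path_pullback RR f g)) (track_section x).
Proof.
move=> [b _ bx]; exists b => //.
have {bx} -> : x = fp_sec UX b by exact: val_inj.
apply: val_inj; congr (_, _); apply: val_inj; congr (_, _).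
  by rewrite -[RHS]/(fp_proj X (fp_sec X b)) fp_secK.
by apply/continuousEP => t; rewrite -[RHS]/(H (_, t)) H_sec.
Qed.
End PathSection.

(** * Cup products and the cohomological bound *)

Section Products.
Variables (RR : realType) (R : comPzRingType) (X : topologicalType) (A : set X).

Fixpoint cup_cocycles (z : nat -> cocycles RR R A) n : cocycles RR R A :=
  if n is m.+1 then cup_cocycle (cup_cocycles z m) (z n) else z 0%N.

Lemma cup_upto_class (u : nat -> cohomology RR R A) z n :
  (forall i, (i <= n)%N -> coh_class (z i) = u i) ->
  cup_upto u n = coh_class (cup_cocycles z n).
Proof.
elim: n => [|n IHn] zu /=; first by rewrite zu.
rewrite IHn => [|i lei]; last by rewrite zu // leqW.
by rewrite -zu // cup_coh_class.
Qed.

Lemma vanish_cup_cocycles (U : nat -> set X) z n :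
    (forall i, (i <= n)%N -> vanish_on (U i) (\val (z i))) ->
  forall i, (i <= n)%N -> vanish_on (U i) (\val (cup_cocycles z n)).
Proof.
elim: n => [|n IHn] zU i /=; first by rewrite leqn0 => /eqP ->; exact: zU.
rewrite leq_eqVlt ltnS => /predU1P[->|lein]; first exact/vanish_cupr/zU.
by apply: vanish_cupl; apply: IHn => // j lej; apply: zU; rewrite leqW.
Qed.

(** Since [A] is contained in a member of the cover, the primitive given by
    [small_primitive] vanishes on the simplices of [A]. *)
Lemma small_cocycle_eq0 (I : Type) (U : I -> set X) (z : cocycles RR R A) i0 :
    (forall i, open (U i)) -> (forall x, exists i, U i x) -> A `<=` U i0 ->
    (forall i, vanish_on (U i) (\val z)) ->
  coh_class z = 0.
Proof.
move=> oU covU AU zU; have [rz dz] := cocycleP _ _ (valP z).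
have [b bU zb] := small_primitive oU covU dz zU.
apply/coh_class_eq0; apply: (truncate_primitive rz _ zb) => n s sA.
by apply: (bU i0); exact: subset_trans sA AU.
Qed.
End Products.

Lemma least_le (S S' : set nat) : S' `<=` S -> (least S <= least S')%E.
Proof.
move=> S'S; have SS' n : n \in S' -> n \in S by move=> /set_mem/S'S/mem_set.
rewrite /least; case: pselect => [exS|nS]; case: pselect => [exS'|_] //.
- rewrite lee_fin lez_nat; case: ex_minnP => m _; apply.
  by case: ex_minnP => k /SS'.
- by case: nS; have [n /SS'] := exS'; exists n.
Qed.

Theorem proposition7p8 (RR : realType) (R : comPzRingType)
    (B : topologicalType) (X Y : fpSpace B) (f g : fpMap X Y) :
  (nilpotency (fp_kernel RR R (path_pullback_proj RR f g))
     <= fp_distance RR f g)%E.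
Proof.
apply: least_le => n [U [secU [oU covU homU]]] u ker_u.
have /choice[z zP] : forall i, exists z : cocycles RR R (range (fp_sec X)),
    (i <= n)%N -> coh_class z = u i /\ vanish_on (U (inord i)) (\val z).
  move=> i; have [lein|gtin] := leqP i n; last by exists 0.
  have [H [H_cts H0 H1 H_proj H_sec]] := homU (inord i).
  have [z zu zU] := kernel_vanish_on
    (@track_section_cts _ _ _ _ _ _ _ _ _ H_cts H0 H1 H_proj) (fun=> erefl)
    (@track_section_sec _ _ _ _ _ _ _ _ _ H_cts H0 H1 H_proj H_sec) (ker_u i lein).
  by exists z.
rewrite (cup_upto_class (fun i lei => (zP i lei).1)).
apply: (@small_cocycle_eq0 _ _ _ _ 'I_n.+1 U _ ord0) => // [x|_ [b _ <-]|i] //.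
  have [i _ Uix] : (\bigcup_i U i) x by rewrite covU.
  by exists i.
rewrite -(inord_val i).
apply: (@vanish_cup_cocycles _ _ _ _ (fun j => U (inord j)) _ n) => [j lej|].
  by case: (zP j lej).
by rewrite -ltnS.
Qed.
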